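(* Let $V,W$ be graded vector spaces over a field of characteristic $0$, let $\varphi\colon V\to V\otimes V$ be a linear map with $\operatorname{Im}\varphi\subset\mathbb L^2(V)$, and let $\psi\colon V\to W$ be a homogeneous linear map. For each planar rooted binary tree $T$ with $k$ leaves ($k\ge2$), $$\frac{1}{|\mathrm{Aut}\,T|}\,Q_T\circ P_T=\sum_{S\in\overline T}P_S .$$
   Context: $\mathbb L(V)\subset T(V)$ is the free graded Lie algebra generated by (graded) commutators on $V$ inside the tensor algebra, and $\mathbb L^k(V)$ is its part of tensor length $k$. $\mathscr{PT}_k$ is the set of isomorphism classes of planar rooted binary trees with $k$ leaves; $|$ denotes the trivial tree, and every $T\in\mathscr{PT}_k$ with $k\ge2$ is the grafting of a left subtree $T'$ and a right subtree $T''$ onto a binary root vertex. Define $\varphi_T\colon V\to V^{\otimes k}$ recursively by $\varphi_|=\mathrm{id}_V$ and $\varphi_T=(\varphi_{T'}\otimes\varphi_{T''})\circ\varphi$ when $T$ is the grafting of $T'$ and $T''$. Put $P_T=\psi^{\otimes k}\circ\varphi_T\colon V\to W^{\otimes k}$. Let $Q_T\colon W^{\otimes k}\to\mathbb L^k(W)\subset W^{\otimes k}$ be the linear map given by the nested commutator bracket moving down from the leaves to the root of $T$; for example, for the tree with four leaves whose left and right subtrees each have two leaves, $Q_T=[\,,]\circ([\,,]\otimes[\,,])$. $\overline T\subset\mathscr{PT}_k$ is the subset of all planar embeddings of trees that are isomorphic to $T$ as non-planar trees, and $\mathrm{Aut}\,T$ is the automorphism group of $T$ as a non-planar rooted tr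ee.
   Formalization: The linear map φ is additionally assumed to preserve the parity of degree, and the homogeneous map ψ to have even degree; without these conditions the identity fails because of signs. *)

(* Defs.v *)
From HB Require Import structures.
From mathcomp Require Import all_boot all_order all_algebra perm finmap.
From mathcomp Require Import boolp.
From mathcomp Require Import monalg.

Set Implicit Arguments.
Unset Strict Implicit.
Unset Printing Implicit Defensive.

Import GRing.Theory.
Local Open Scope ring_scope.
Local Open Scope quotient_scope.

(* A graded vector space is a family V : int -> lmodType F of vector spaces, to
   be thought of as the direct sum of the V i.  A (not necessarily homogeneous)
   linear map from it to a vector space A is a family of linear maps V i -> A. *)

Section HomogeneousElements.
Variables (F : fieldType) (V : int -> lmodType F).

Definition homelt := {i : int & V i}.
Definition helt (i : int) (v : V i) : homelt := Tagged (fun i => V i) v.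
HB.instance Definition _ := Choice.on homelt.

End HomogeneousElements.

HB.lock Definition mono (F : fieldType) (V : int -> lmodType F)
  (s : seq (homelt V)) : {malg F[{fmonom homelt V}]} := << FMonom s >>.

Section TensorAlgebra.
Variables (F : fieldType) (V : int -> lmodType F).
Local Notation homelt := (homelt V).
Local Notation free_alg := {malg F[{fmonom homelt}]}.

Lemma monoE (s : seq homelt) : mono s = << FMonom s >> :> free_alg.
Proof. by rewrite mono.unlock. Qed.

Definition lin_rel i (a : F) (u v : V i) : free_alg :=
  mono [:: helt (a *: u + v)] - (a *: mono [:: helt u] + mono [:: helt v]).

(* The two-sided ideal of the free algebra generated by the linearity relations
   in each V i. *)
Inductive tensor_rel : free_alg -> Prop :=
| TensorRel0 : tensor_rel 0
| TensorRelD p q i a (u v : V i) x :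
    tensor_rel x -> tensor_rel (p * lin_rel a u v * q + x).

Definition tensor_ideal : {pred free_alg} := fun x => `[< tensor_rel x >].

Lemma tensor_relD x y : tensor_rel x -> tensor_rel y -> tensor_rel (x + y).
Proof.
move=> + Hy; elim=> [|p q i a u v z _ IH]; first by rewrite add0r.
by rewrite -addrA; constructor.
Qed.

Lemma tensor_relMl p x : tensor_rel x -> tensor_rel (p * x).
Proof.
elim=> [|p' q i a u v z _ IH]; first by rewrite mulr0; constructor.
by rewrite mulrDr !mulrA; constructor.
Qed.

Lemma tensor_relMr p x : tensor_rel x -> tensor_rel (x * p).
Proof.
elim=> [|p' q i a u v z _ IH]; first by rewrite mul0r; constructor.
by rewrite mulrDl -mulrA; constructor.
Qed.

Lemma tensor_relZ c x : tensor_rel x -> tensor_rel (c *: x).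
Proof. by rewrite -mul_malgC; apply: tensor_relMl. Qed.

Fact tensor_ideal_zmod_closed : zmod_closed tensor_ideal.
Proof.
split=> [|x y]; rewrite !unfold_in /tensor_ideal /=.
  by apply/asboolP; constructor.
move=> /asboolP Hx /asboolP Hy; apply/asboolP.
by rewrite -scaleN1r; apply/tensor_relD/tensor_relZ.
Qed.
HB.instance Definition _ :=
  GRing.isZmodClosed.Build free_alg tensor_ideal tensor_ideal_zmod_closed.

Definition tensor_algebra := Quotient.quot tensor_ideal.
HB.instance Definition _ := GRing.Zmodule.on tensor_algebra.
HB.instance Definition _ := ZmodQuotient.on tensor_algebra.
Local Notation TA := tensor_algebra.

Lemma tpi_eqP (x y : free_alg) :
  reflect (tensor_rel (x - y)) (\pi_TA x == \pi_TA y).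
Proof. by rewrite -Quotient.idealrBE; apply: asboolP. Qed.

Lemma tpi_repr x : tensor_rel (repr (\pi_TA x) - x).
Proof. by apply/tpi_eqP; rewrite reprK. Qed.

Definition tone : TA := \pi_TA 1.
Definition tmul : TA -> TA -> TA :=
  locked (fun x y => \pi_TA (repr x * repr y)).
Definition tscale : F -> TA -> TA := locked (fun c x => \pi_TA (c *: repr x)).

Lemma tpiD x y : \pi_TA (x + y) = \pi_TA x + \pi_TA y.
Proof. by rewrite raddfD. Qed.

Lemma tmul_pi x y : tmul (\pi_TA x) (\pi_TA y) = \pi_TA (x * y).
Proof.
rewrite /tmul -lock; apply/eqP/tpi_eqP.
have -> : (repr (\pi_TA x) : free_alg) * repr (\pi_TA y) - x * y =
  (repr (\pi_TA x) - x) * repr (\pi_TA y) + x * (repr (\pi_TA y) - y).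
  by rewrite mulrBl mulrBr addrA subrK.
by apply: tensor_relD;
  [apply/tensor_relMr/tpi_repr | apply/tensor_relMl/tpi_repr].
Qed.

Lemma tscale_pi c x : tscale c (\pi_TA x) = \pi_TA (c *: x).
Proof.
rewrite /tscale -lock; apply/eqP/tpi_eqP.
by rewrite -scalerBr; apply/tensor_relZ/tpi_repr.
Qed.

Fact tscaleA c d x : tscale c (tscale d x) = tscale (c * d) x.
Proof. by rewrite -[x]reprK !tscale_pi scalerA. Qed.
Fact tscale1 : left_id 1 tscale.
Proof. by move=> x; rewrite -[x]reprK tscale_pi scale1r. Qed.
Fact tscaleDr : right_distributive tscale +%R.
Proof.
by move=> c x y; rewrite -[x]reprK -[y]reprK -tpiD !tscale_pi scalerDr tpiD.
Qed.
Fact tscaleDl x : {morph tscale^~ x : c d / c + d}.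
Proof. by move=> c d; rewrite -[x]reprK !tscale_pi scalerDl tpiD. Qed.
HB.instance Definition _ := GRing.Zmodule_isLmodule.Build F TA
  tscaleA tscale1 tscaleDr tscaleDl.

Fact tmulA : associative tmul.
Proof.
by move=> x y z; rewrite -[x]reprK -[y]reprK -[z]reprK !tmul_pi mulrA.
Qed.
Fact tmul1 : left_id tone tmul.
Proof. by move=> x; rewrite -[x]reprK tmul_pi mul1r. Qed.
Fact tmulr1 : right_id tone tmul.
Proof. by move=> x; rewrite -[x]reprK tmul_pi mulr1. Qed.
Fact tmulDl : left_distributive tmul +%R.
Proof.
move=> x y z; rewrite -[x]reprK -[y]reprK -[z]reprK -tpiD !tmul_pi.
by rewrite mulrDl tpiD.
Qed.
Fact tmulDr : right_distributive tmul +%R.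
Proof.
move=> x y z; rewrite -[x]reprK -[y]reprK -[z]reprK -tpiD !tmul_pi.
by rewrite mulrDr tpiD.
Qed.
Fact tone_neq0 : tone != 0.
Proof.
rewrite -(raddf0 (\pi_TA)); apply/eqP => /eqP /tpi_eqP; rewrite subr0 => H.
have : mcoeff (mone : {fmonom homelt}) (1 : {malg F[{fmonom homelt}]}) = 0.
  elim: H => [|p q i a u v x _ IH]; first by rewrite mcoeff0.
  rewrite mcoeffD IH addr0 (rmorphM (mcoeff mone)) (rmorphM (mcoeff mone)).
  suff e : mcoeff mone (lin_rel a u v) = 0 by rewrite [X in _ * X * _]e mulr0 mul0r.
  have m1 (w : homelt) : mcoeff mone (mono [:: w]) = 0 by rewrite monoE mcoeffU fmP fm1.
  rewrite mcoeffB mcoeffD mcoeffZ.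
  have -> : a * mcoeff mone (mono [:: helt u]) = a * 0 by congr (_ * _); apply: m1.
  by rewrite mulr0 add0r; apply/eqP; rewrite subr_eq0; apply/eqP; rewrite [RHS]m1; apply: m1.
by rewrite mcoeffU eqxx => /eqP; rewrite oner_eq0.
Qed.
HB.instance Definition _ := GRing.Zmodule_isNzRing.Build TA
  tmulA tmul1 tmulr1 tmulDl tmulDr tone_neq0.

Lemma tpiM x y : \pi_TA (x * y) = \pi_TA x * \pi_TA y.
Proof. by rewrite -tmul_pi. Qed.

Lemma tpiZ c x : \pi_TA (c *: x) = c *: \pi_TA x.
Proof. by rewrite -tscale_pi. Qed.

Fact tscaleAl (c : F) (x y : TA) : c *: (x * y) = (c *: x) * y.
Proof. by rewrite -[x]reprK -[y]reprK -tpiM -!tpiZ -tpiM scalerAl. Qed.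
HB.instance Definition _ := GRing.Lmodule_isLalgebra.Build F TA tscaleAl.

Lemma mul_malgCr (c : F) (x : free_alg) : x * c%:MP = c *: x.
Proof.
rewrite malgM_def fgmulgU malgZ_def; apply: eq_bigr => k _.
by rewrite mulm1 mulrC.
Qed.

Lemma malg_scalerAr (c : F) (x y : free_alg) : c *: (x * y) = x * (c *: y).
Proof. by rewrite -(mul_malgCr c y) mulrA mul_malgCr. Qed.

Fact tscaleAr (c : F) (x y : TA) : c *: (x * y) = x * (c *: y).
Proof.
rewrite -[x]reprK -[y]reprK -tpiM -!tpiZ -tpiM.
by rewrite malg_scalerAr.
Qed.
HB.instance Definition _ := GRing.Lalgebra_isAlgebra.Build F TA tscaleAr.


End TensorAlgebra.

HB.lock Definition word (F : fieldType) (V : int -> lmodType F)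
  (s : seq (homelt V)) : tensor_algebra V := \pi_(tensor_algebra V) (mono s).

Section Words.
Variables (F : fieldType) (V : int -> lmodType F).
Local Notation homelt := (homelt V).
Local Notation free_alg := {malg F[{fmonom homelt}]}.
Local Notation TA := (tensor_algebra V).

Lemma wordE (s : seq homelt) : word s = \pi_TA (mono s).
Proof. by rewrite word.unlock. Qed.

Lemma mono_nil : mono ([::] : seq homelt) = 1.
Proof. by rewrite monoE -fmoneE. Qed.

Lemma word_nil : word ([::] : seq homelt) = 1.
Proof. by rewrite wordE mono_nil. Qed.

Lemma mono_cat (s t : seq homelt) : mono (s ++ t) = mono s * mono t.
Proof. by rewrite !monoE [RHS]malgM_def fgmulUU mulr1 [mmul _ _]fmmulE. Qed.

Lemma word_cat (s t : seq homelt) : word (s ++ t) = word s * word t.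
Proof. by rewrite !wordE mono_cat tpiM. Qed.

Lemma word_lin s1 s2 i a (u v : V i) :
  word (s1 ++ helt (a *: u + v) :: s2) =
  a *: word (s1 ++ helt u :: s2) + word (s1 ++ helt v :: s2).
Proof.
have e (x : V i) :
    word (s1 ++ helt x :: s2) = word s1 * word [:: helt x] * word s2.
  by rewrite -!word_cat -catA.
rewrite !e scalerAl scalerAr -mulrDl -mulrDr; congr (_ * _ * _).
rewrite !wordE -tpiZ -tpiD; apply/eqP/tpi_eqP.
have := TensorRelD 1 1 a u v (TensorRel0 V).
by rewrite mulr1 mul1r addr0.
Qed.

(* The tensors spanned by the words (products of homogeneous vectors) that
   satisfy P. *)
Definition word_span (P : pred (seq homelt)) (x : TA) : Prop :=
  exists r : seq (F * seq homelt),
    all (fun c => P c.2) r /\ x = \sum_(c <- r) c.1 *: word c.2.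

Definition tensor_length (k : nat) : TA -> Prop :=
  word_span (fun s => size s == k).

Definition wdeg (s : seq homelt) : int := \sum_(h <- s) tag h.

Section Lift.
Variable M : lmodType F.

(* Multilinear functions of words of homogeneous vectors, of arbitrary length.
   They extend uniquely to linear maps on the tensor algebra, by [lift]. *)
Record multilinear := Multilinear {
  mlfun :> seq homelt -> M;
  mlfunP : forall s1 s2 i a (u v : V i),
    mlfun (s1 ++ helt (a *: u + v) :: s2) =
    a *: mlfun (s1 ++ helt u :: s2) + mlfun (s1 ++ helt v :: s2)
}.

Definition lin_ext (f : seq homelt -> M) (g : free_alg) : M :=
  \sum_(w <- msupp g) mcoeff w g *: f w.

Lemma lin_extEw f (g : free_alg) (d : {fset {fmonom homelt}}) :
  (msupp g `<=` d)%fset -> lin_ext f g = \sum_(w <- d) mcoeff w g *: f w.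
Proof.
move=> sd; rewrite /lin_ext (big_fset_incl _ sd) //= => w _ wN.
by rewrite mcoeff_outdom // scale0r.
Qed.

Fact lin_ext_linear f : linear (lin_ext f).
Proof.
move=> a x y; pose d := (msupp x `|` msupp y)%fset.
rewrite (@lin_extEw f x d) ?fsubsetUl // (@lin_extEw f y d) ?fsubsetUr //.
rewrite (@lin_extEw f _ d).
  rewrite scaler_sumr -big_split; apply: eq_bigr => w _ /=.
  by rewrite mcoeffD mcoeffZ scalerDl scalerA.
apply: fsubset_trans (msuppD_le _ _) _.
by apply: fsetSU; apply: msuppZ_le.
Qed.
HB.instance Definition _ f :=
  GRing.isLinear.Build F free_alg M _ (lin_ext f) (lin_ext_linear f).

Lemma lin_ext_mono f s : lin_ext f (mono s) = f s.
Proof. by rewrite monoE /lin_ext msuppU1 big_seq_fset1 mcoeffU eqxx scale1r. Qed.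

Lemma free_algE (x : free_alg) : x = \sum_(w <- msupp x) mcoeff w x *: mono w.
Proof.
rewrite [LHS](monalgE x); apply: eq_bigr => w _; apply/malgP => k.
by rewrite mcoeffZ monoE !mcoeffU fmK mulr_natr.
Qed.

Lemma free_alg_ind (P : free_alg -> Prop) :
  P 0 -> (forall c s x, P x -> P (c *: mono s + x)) -> forall x, P x.
Proof.
move=> P0 PD x; rewrite (free_algE x).
by elim: (enum_fset _) => [|w r IH]; rewrite ?big_nil ?big_cons //; apply: PD.
Qed.

Lemma lin_ext_rel1 (f : multilinear) s t i a (u v : V i) :
  lin_ext f (mono s * lin_rel a u v * mono t) = 0.
Proof.
have e h : lin_ext f (mono s * mono [:: h] * mono t) = f (s ++ h :: t).
  by rewrite -(mono_cat s) -(mono_cat _ t) -catA lin_ext_mono.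
have L (x y z : free_alg) : lin_ext f (mono s * (x - (a *: y + z)) * mono t) =
    lin_ext f (mono s * x * mono t) -
    (a *: lin_ext f (mono s * y * mono t) + lin_ext f (mono s * z * mono t)).
  rewrite mulrBr mulrDr -malg_scalerAr mulrBl mulrDl -scalerAl.
  by rewrite linearB linearD linearZ.
rewrite /lin_rel L; apply/eqP; rewrite subr_eq0; apply/eqP.
rewrite [LHS]e mlfunP; congr (_ *: _ + _); last by rewrite [RHS]e.
by rewrite [RHS]e.
Qed.

Lemma lin_ext_mid (f : multilinear) (r : free_alg) :
  (forall s t, lin_ext f (mono s * r * mono t) = 0) ->
  forall p q, lin_ext f (p * r * q) = 0.
Proof.
move=> r0 p q; elim/free_alg_ind: p => [|c s p IHp].
  by rewrite !mul0r linear0.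
rewrite mulrDl mulrDl -!scalerAl (lin_ext_linear f c) [X in _ + X]IHp addr0.
suff -> : lin_ext f (mono s * r * q) = 0 by rewrite scaler0.
elim/free_alg_ind: q {IHp} => [|d t q IHq]; first by rewrite mulr0 linear0.
rewrite mulrDr -malg_scalerAr (lin_ext_linear f d) [X in _ + X]IHq addr0.
by rewrite r0 scaler0.
Qed.

Lemma lin_ext_rel (f : multilinear) x : tensor_rel x -> lin_ext f x = 0.
Proof.
elim=> [|p q i a u v {}x _ IH]; first by rewrite linear0.
rewrite linearD /= [X in _ + X]IH addr0; apply: lin_ext_mid => s t.
exact: lin_ext_rel1.
Qed.

End Lift.
End Words.

HB.lock Definition lift (F : fieldType) (V : int -> lmodType F) (M : lmodType F)
  (f : multilinear V M) (x : tensor_algebra V) : M := lin_ext f (repr x).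

Section LiftTheory.
Variables (F : fieldType) (V : int -> lmodType F).
Local Notation homelt := (homelt V).
Local Notation free_alg := {malg F[{fmonom homelt}]}.
Local Notation TA := (tensor_algebra V).

Section Lift.
Variable M : lmodType F.
Implicit Types f : multilinear V M.

Lemma lift_pi f (x : free_alg) : lift f (\pi_TA x) = lin_ext f x.
Proof.
by rewrite lift.unlock; apply/eqP; rewrite -subr_eq0 -linearB /= lin_ext_rel //; apply: tpi_repr.
Qed.

Fact lift_linear f : linear (lift f).
Proof.
move=> a x y; rewrite -[x]reprK -[y]reprK -tpiZ -tpiD !lift_pi.
by rewrite linearP.
Qed.
HB.instance Definition _ f :=
  GRing.isLinear.Build F TA M _ (lift f) (lift_linear f).

Lemma lift_word f (s : seq homelt) : lift f (word s) = f s.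
Proof. by rewrite wordE lift_pi lin_ext_mono. Qed.

End Lift.

Lemma eq_on_words (M : lmodType F) (f g : {linear TA -> M}) :
  (forall s, f (word s) = g (word s)) -> f =1 g.
Proof.
move=> fg x; rewrite -[x]reprK; elim/free_alg_ind: (repr x) => [|c s y IH].
  by rewrite raddf0 !linear0.
by rewrite tpiD tpiZ !linearP /= IH -wordE fg.
Qed.

Definition gen i (v : V i) : TA := word [:: helt v].

Fact gen_linear i : linear (@gen i).
Proof. by move=> a u v; apply: (word_lin [::] [::]). Qed.
HB.instance Definition _ i :=
  GRing.isLinear.Build F (V i) TA _ (@gen i) (@gen_linear i).

Definition bracket_words (s t : seq homelt) : TA :=
  word (s ++ t) - (-1 : F) ^ (wdeg s * wdeg t) *: word (t ++ s).

Lemma wdeg_helt s1 s2 i (u v : V i) :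
  wdeg (s1 ++ helt u :: s2) = wdeg (s1 ++ helt v :: s2).
Proof. by rewrite /wdeg !big_cat !big_cons. Qed.

Fact bracket_wordsP s s1 s2 i a (u v : V i) :
  bracket_words s (s1 ++ helt (a *: u + v) :: s2) =
  a *: bracket_words s (s1 ++ helt u :: s2) +
  bracket_words s (s1 ++ helt v :: s2).
Proof.
rewrite /bracket_words 2!(wdeg_helt s1 s2 _ v) !catA !word_lin -!catA !cat_cons.
rewrite catA word_lin -!catA.
rewrite scalerDr scalerBr !scalerA [a * _]mulrC.
by rewrite opprD addrACA.
Qed.
Definition bracket_wordr s := Multilinear (bracket_wordsP s).

Fact bracket_wordsPl t s1 s2 i a (u v : V i) :
  bracket_words (s1 ++ helt (a *: u + v) :: s2) t =
  a *: bracket_words (s1 ++ helt u :: s2) t +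
  bracket_words (s1 ++ helt v :: s2) t.
Proof.
rewrite /bracket_words 2!(wdeg_helt s1 s2 _ v) -!catA !cat_cons !word_lin.
rewrite !(catA t) word_lin scalerDr scalerBr !scalerA [a * _]mulrC.
by rewrite opprD addrACA.
Qed.

Fact bracket_wordlP y s1 s2 i a (u v : V i) :
  lift (bracket_wordr (s1 ++ helt (a *: u + v) :: s2)) y =
  a *: lift (bracket_wordr (s1 ++ helt u :: s2)) y +
  lift (bracket_wordr (s1 ++ helt v :: s2)) y.
Proof.
rewrite lift.unlock /lin_ext scaler_sumr -big_split; apply: eq_bigr => w _ /=.
by rewrite bracket_wordsPl scalerDr !scalerA [a * _]mulrC.
Qed.
Definition bracket_wordl y : multilinear V TA :=
  @Multilinear F V TA (fun s => lift (bracket_wordr s) y) (bracket_wordlP y).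

(* The graded commutator x y - (-1)^(|x||y|) y x, extended bilinearly from
   homogeneous elements. *)
Definition bracket (x y : TA) : TA := lift (bracket_wordl y) x.

Lemma bracket_word s t : bracket (word s) (word t) = bracket_words s t.
Proof. by rewrite /bracket lift_word /= lift_word. Qed.

Fact bracket_linearl y : linear (bracket^~ y).
Proof. by move=> a x x'; rewrite /bracket linearP. Qed.

Fact bracket_linearr x : linear (bracket x).
Proof.
move=> a y z; rewrite -[x]reprK /bracket !lift_pi /lin_ext scaler_sumr.
rewrite -big_split; apply: eq_bigr => w _ /=.
by rewrite linearP scalerDr !scalerA mulrC.
Qed.

(* The free graded Lie algebra on V, as the graded Lie subalgebra of the tensor
   algebra generated by V. *)
Inductive free_lie : TA -> Prop :=
| FreeLieGen i (v : V i) : free_lie (gen v)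
| FreeLieBracket x y : free_lie x -> free_lie y -> free_lie (bracket x y)
| FreeLie0 : free_lie 0
| FreeLieLin a x y : free_lie x -> free_lie y -> free_lie (a *: x + y).

Definition free_lie_length (k : nat) (x : TA) : Prop :=
  free_lie x /\ tensor_length k x.

End LiftTheory.

Section TensorMaps.
Variables (F : fieldType) (V : int -> lmodType F).

(* f (x) g : V (x) V -> A, v (x) w |-> f v * g w, extended by 0 to the tensors of
   other lengths.  No Koszul sign is needed when f and g preserve the parity of
   the degree. *)
Section Tens2.
Variables (A : algType F) (f g : forall i, {linear V i -> A}).

Definition tens2_words (s : seq (homelt V)) : A :=
  if s is [:: x; y] then f (tag x) (tagged x) * g (tag y) (tagged y) else 0.

Fact tens2_wordsP s1 s2 i a (u v : V i) :
  tens2_words (s1 ++ helt (a *: u + v) :: s2) =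
  a *: tens2_words (s1 ++ helt u :: s2) + tens2_words (s1 ++ helt v :: s2).
Proof.
case: s1 s2 => [|x [|y s1]] [|z [|t s2]] //=; rewrite ?scaler0 ?addr0 //.
- by rewrite linearP mulrDl scalerAl.
- by rewrite linearP mulrDr scalerAr.
- by case: s1 => *; rewrite /= ?scaler0 ?addr0.
- by case: s1 => *; rewrite /= ?scaler0 ?addr0.
by case: s1 => *; rewrite /= ?scaler0 ?addr0.
Qed.

Definition tens2 : tensor_algebra V -> A := lift (Multilinear tens2_wordsP).
HB.instance Definition _ := GRing.Linear.on tens2.
End Tens2.

(* The tensor product of psi with itself, on tensors of every length.  No Koszul
   sign is needed when psi has even degree. *)
Section TensorMap.
Variables (W : int -> lmodType F) (p : int).
Variable psi : forall i, {linear V i -> W (i + p)}.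

Definition tmap_words (s : seq (homelt V)) : tensor_algebra W :=
  word [seq helt (psi (tag x) (tagged x)) | x <- s].

Fact tmap_wordsP s1 s2 i a (u v : V i) :
  tmap_words (s1 ++ helt (a *: u + v) :: s2) =
  a *: tmap_words (s1 ++ helt u :: s2) + tmap_words (s1 ++ helt v :: s2).
Proof. by rewrite /tmap_words !map_cat /= linearP word_lin. Qed.

Definition tmap : tensor_algebra V -> tensor_algebra W :=
  lift (Multilinear tmap_wordsP).
HB.instance Definition _ := GRing.Linear.on tmap.
End TensorMap.

(* [,] o (f (x) g) on the tensors of length m + n, where f and g are defined on
   the tensors of length m and n; extended by 0 to the tensors of other
   lengths. *)
Section BracketMap.
Variables (m n : nat) (f g : {linear tensor_algebra V -> tensor_algebra V}).

Definition bracket_map_words (s : seq (homelt V)) : tensor_algebra V :=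
  if size s == (m + n)%N
  then bracket (f (word (take m s))) (g (word (drop m s))) else 0.

Fact bracket_map_wordsP s1 s2 i a (u v : V i) :
  bracket_map_words (s1 ++ helt (a *: u + v) :: s2) =
  a *: bracket_map_words (s1 ++ helt u :: s2) +
  bracket_map_words (s1 ++ helt v :: s2).
Proof.
rewrite /bracket_map_words !size_cat /=; case: ifP => _; last first.
  by rewrite scaler0 addr0.
rewrite !take_cat !drop_cat; case: ltnP => [lt_m|le_m].
  by rewrite word_lin linearP bracket_linearr.
case e : (m - size s1)%N => [|j] /=.
  by rewrite (word_lin [::]) linearP bracket_linearr.
by rewrite word_lin linearP bracket_linearl.
Qed.

Definition bracket_map : tensor_algebra V -> tensor_algebra V :=
  lift (Multilinear bracket_map_wordsP).
HB.instance Definition _ := GRing.Linear.on bracket_map.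
End BracketMap.

End TensorMaps.

(* Isomorphism classes of planar rooted binary trees. *)
Inductive pbtree := Leaf | Node of pbtree & pbtree.

Fixpoint pbtree_encode (T : pbtree) : GenTree.tree void :=
  if T is Node l r then GenTree.Node 1 [:: pbtree_encode l; pbtree_encode r]
  else GenTree.Node 0 [::].
Fixpoint pbtree_decode (t : GenTree.tree void) : pbtree :=
  if t is GenTree.Node 1 [:: l; r] then Node (pbtree_decode l) (pbtree_decode r)
  else Leaf.
Fact pbtree_encodeK : cancel pbtree_encode pbtree_decode.
Proof. by elim=> //= l -> r ->. Qed.
HB.instance Definition _ := Countable.copy pbtree (can_type pbtree_encodeK).

Fixpoint nleaves (T : pbtree) : nat :=
  if T is Node l r then (nleaves l + nleaves r)%N else 1.

Record PT (k : nat) := MkPT { ptree :> pbtree; _ : nleaves ptree == k }.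
HB.instance Definition _ k := [isSub for @ptree k].
HB.instance Definition _ k := [Countable of PT k by <:].

Fixpoint pbtree_enum (h : nat) : seq pbtree :=
  if h is h'.+1 then
    Leaf :: [seq Node l r | l <- pbtree_enum h', r <- pbtree_enum h']
  else [::].

Lemma nleaves_gt0 T : (0 < nleaves T)%N.
Proof. by elim: T => //= l Hl r _; rewrite addn_gt0 Hl. Qed.

Lemma mem_pbtree_enum h T : (nleaves T <= h)%N -> T \in pbtree_enum h.
Proof.
elim: h T => [|h IH] [|l r] //=; first by rewrite leqNgt addn_gt0 nleaves_gt0.
move=> Hlr; rewrite inE /=; apply: allpairs_f; apply: IH.
  by rewrite -ltnS (leq_trans _ Hlr) // -addn1 leq_add2l nleaves_gt0.
by rewrite -ltnS (leq_trans _ Hlr) // -add1n leq_add2r nleaves_gt0.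
Qed.

Definition PT_enum k : seq (PT k) := undup (pmap insub (pbtree_enum k)).
Fact PT_enumP k : Finite.axiom (PT_enum k).
Proof.
apply: Finite.uniq_enumP; first exact: undup_uniq.
case=> T HT; rewrite mem_undup mem_pmap_sub /=.
by apply: mem_pbtree_enum; rewrite (eqP HT).
Qed.
HB.instance Definition _ k := isFinite.Build (PT k) (@PT_enumP k).

(* The underlying rooted tree: a vertex is given by the path from the root to
   it (false = left, true = right). *)
Fixpoint vertices (T : pbtree) : seq (seq bool) :=
  if T is Node l r then
    [::] :: map (cons false) (vertices l) ++ map (cons true) (vertices r)
  else [:: [::]].

Definition vertex (T : pbtree) := seq_sub (vertices T).
HB.instance Definition _ T := Finite.on (vertex T).

Definition is_root T (x : vertex T) : bool := ssval x == [::].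
Definition is_child T (x y : vertex T) : bool :=
  [exists b, ssval y == rcons (ssval x) b].

(* f preserves the root and the edges, oriented away from the root *)
Definition rooted_morph S T (f : vertex S -> vertex T) : bool :=
  [forall x, is_root (f x) == is_root x] &&
  [forall x, forall y, is_child (f x) (f y) == is_child x y].

(* Isomorphism and automorphisms of non-planar rooted trees. *)
Definition tree_iso (S T : pbtree) : bool :=
  [exists f : {ffun vertex S -> vertex T},
    [&& injectiveb f, [forall y, y \in codom f] & rooted_morph f]].

Definition tree_aut (T : pbtree) : {set {perm vertex T}} :=
  [set f : {perm vertex T} | rooted_morph f].

Definition planar_embeddings k (T : PT k) : {set PT k} :=
  [set S : PT k | tree_iso S T].

Section TreeMaps.
Variable F : fieldType.

(* phi preserves the parity of the degree: it is a sum of homogeneous maps of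
   even degree. *)
Definition parity_preserving (V : int -> lmodType F)
    (phi : forall i, {linear V i -> tensor_algebra V}) : Prop :=
  forall i (v : V i), word_span (fun s => (2 %| wdeg s - i)%Z) (phi i v).

Fixpoint phi_tree (V : int -> lmodType F)
    (phi : forall i, {linear V i -> tensor_algebra V}) (T : pbtree) :
    forall i, {linear V i -> tensor_algebra V} :=
  match T with
  | Leaf => fun i => @gen F V i
  | Node l r => fun i => tens2 (phi_tree phi l) (phi_tree phi r) \o phi i
  end.

Definition P_tree (V W : int -> lmodType F)
    (phi : forall i, {linear V i -> tensor_algebra V})
    (p : int) (psi : forall i, {linear V i -> W (i + p)}) (T : pbtree) (i : int) :
    {linear V i -> tensor_algebra W} :=
  tmap psi \o phi_tree phi T i.

(* Only the restriction of Q_tree W T to the tensors of length nleaves T is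
   meaningful. *)
Fixpoint Q_tree (W : int -> lmodType F) (T : pbtree) :
    {linear tensor_algebra W -> tensor_algebra W} :=
  match T with
  | Leaf => idfun
  | Node l r =>
      bracket_map (nleaves l) (nleaves r) (Q_tree W l) (Q_tree W r)
  end.
End TreeMaps.

(* Main.v *)
Require Import Defs.
From mathcomp Require Import all_boot all_order all_algebra perm.
From mathcomp Require Import zify.

Set Implicit Arguments.
Unset Strict Implicit.
Unset Printing Implicit Defensive.

Import GRing.Theory.
Local Open Scope ring_scope.

(* The expansion Q_T o P_T = sum_S n(S,T) P_S holds, where n(S,T) is the number
   of isomorphisms of non-planar rooted trees from S to T.  By induction on T
   this comes from Q_T o P_T = (q_l (x) q_r) o phi + (q_r (x) q_l) o phi, with
   q_l and q_r the maps of the subtrees l and r of T: the bracket produces the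
   second term with a sign, which the graded antisymmetry of the elements of
   L^2(V) cancels.  An isomorphism between Node a b and Node l r is a pair of
   isomorphisms a -> l and b -> r, or a pair a -> r and b -> l, so n satisfies
   the same recursion.  Finally n(S,T) = |Aut T| whenever it does not vanish. *)

(** * Vertices of planar trees as paths from the root *)

Section Trees.
Implicit Types (S T : pbtree) (h : seq bool -> seq bool).

Definition child_subtree l r (b : bool) : pbtree := if b then r else l.

Lemma mem_nil_vertices T : [::] \in vertices T.
Proof. by case: T. Qed.
Hint Resolve mem_nil_vertices : core.

Lemma mem_cons_vertices l r b p :
  (b :: p \in vertices (Node l r)) = (p \in vertices (child_subtree l r b)).
Proof.
have inj c : injective (cons c : seq bool -> _) by move=> ? ? [].
have other c q s : (c :: q \in map (cons (~~ c)) s) = false.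
  by apply/mapP => -[? _ [] /esym]; case: c.
rewrite /= inE mem_cat /=.
by case: b; rewrite (mem_map (inj _)) ?(other true) ?(other false) ?orbF.
Qed.

Lemma uniq_vertices T : uniq (vertices T).
Proof.
have inj c : injective (cons c : seq bool -> _) by move=> ? ? [].
elim: T => //= l IHl r IHr; rewrite cat_uniq !(map_inj_uniq (inj _)) IHl IHr.
rewrite mem_cat andbT /=; apply/andP; split.
  by apply/norP; split; apply/mapP => -[].
by apply/hasPn => _ /mapP[p _ ->]; apply/mapP => -[].
Qed.

Lemma rcons_vertices T p b : rcons p b \in vertices T -> p \in vertices T.
Proof.
elim: T p => [|l IHl r IHr] [|c p] //.
by rewrite rcons_cons !mem_cons_vertices; case: c; [apply: IHr | apply: IHl].
Qed.

(** * Isomorphisms of rooted trees as maps of paths, and their recursive enumeration *)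

Definition path_child (x y : seq bool) : bool := [exists b, y == rcons x b].

Lemma path_childP x y : reflect (exists b, y = rcons x b) (path_child x y).
Proof. by apply: (iffP existsP) => -[b] => [/eqP|->]; exists b. Qed.

Lemma size_path_child x y : path_child x y -> size y = (size x).+1.
Proof. by case/path_childP => b ->; rewrite size_rcons. Qed.

Lemma path_child_nil y : path_child [::] y = (size y == 1).
Proof.
apply/idP/idP => [/size_path_child -> //|].
by case: y => [|b []] // _; apply/path_childP; exists b.
Qed.

Lemma path_child_cons b c x y :
  path_child (b :: x) (c :: y) = (b == c) && path_child x y.
Proof.
apply/path_childP/andP => [[d] [-> ->]|[/eqP -> /path_childP [d ->]]].
  by split=> //; apply/path_childP; exists d.
by exists d.
Qed.

(** Here [h] is a total function on paths, constrained only on the vertices of [S]. Restriction to a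
    subtree then amounts to adding and dropping one letter, with no membership proofs inside the
    data. *)
Record path_iso S T h : Prop := PathIso {
  path_iso_mem : {in vertices S, forall x, h x \in vertices T};
  path_iso_surj : {in vertices T, forall y, exists2 x, x \in vertices S & h x = y};
  path_iso_inj : {in vertices S &, injective h};
  path_iso_nil : h [::] = [::];
  path_iso_child : {in vertices S &, forall x y,
    path_child (h x) (h y) = path_child x y}
}.

(** Root and edges are preserved, hence so is depth, by induction along the path from the root. *)
Lemma path_iso_size S T h x : path_iso S T h -> x \in vertices S ->
  size (h x) = size x.
Proof.
move=> hP; elim/last_ind: x => [|x b IH] Sx; first by rewrite (path_iso_nil hP).
rewrite (@size_path_child (h x)) ?IH ?size_rcons ?(rcons_vertices Sx) //.
rewrite (path_iso_child hP) ?(rcons_vertices Sx) //.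
by apply/path_childP; exists b.
Qed.

Lemma path_iso_leaf h : path_iso Leaf Leaf h <-> h [::] = [::].
Proof.
split=> [|h0]; first exact: path_iso_nil.
split=> //.
- by move=> x; rewrite inE => /eqP ->; rewrite h0.
- by move=> x; rewrite inE => /eqP ->; exists [::].
- by move=> x y; rewrite !inE => /eqP -> /eqP ->.
by move=> x y; rewrite !inE => /eqP -> /eqP ->; rewrite h0.
Qed.

Lemma path_iso_leaf_node l r h : ~ path_iso Leaf (Node l r) h.
Proof.
move=> hP; have [|x] := path_iso_surj hP (x := [:: false]).
  by rewrite mem_cons_vertices.
by rewrite inE => /eqP ->; rewrite (path_iso_nil hP).
Qed.

Lemma path_iso_node_leaf l r h : ~ path_iso (Node l r) Leaf h.
Proof.
move=> hP; have Sf : [:: false] \in vertices (Node l r) by rewrite mem_cons_vertices.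
have := path_iso_size hP Sf; have := path_iso_mem hP Sf.
by rewrite inE => /eqP ->.
Qed.

(** The children of the root go to the children of the root, in order or exchanged ([c] true), and
    descendants follow their ancestors. *)
Lemma path_iso_node l r l' r' h :
  path_iso (Node l r) (Node l' r') h <->
  h [::] = [::] /\ exists c, forall b,
    {in vertices (child_subtree l r b), forall p,
       h (b :: p) = (b (+) c) :: behead (h (b :: p))} /\
    path_iso (child_subtree l r b) (child_subtree l' r' (b (+) c))
      (fun p => behead (h (b :: p))).
Proof.
split=> [hP|[h0 [c hc]]].
  split; first exact: path_iso_nil hP.
  have V1 b : [:: b] \in vertices (Node l r) by rewrite mem_cons_vertices.
  have hb b : h [:: b] = [:: head false (h [:: b])].
    by have := path_iso_size hP (V1 b); case: (h _) => [|? []].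
  (* The image of the left child decides [c]; injectivity then forces the image of the right
     child. *)
  pose c := head false (h [:: false]).
  have h1 b : h [:: b] = [:: b (+) c].
    case: b; last exact: hb.
    rewrite hb; congr [:: _].
    have : h [:: true] != h [:: false].
      by apply/eqP => /(path_iso_inj hP (V1 _) (V1 _)).
    by rewrite (hb true) (hb false) -/c; case: (head _ _) c => [] [].
  (* The first letter of the image is inherited along edges, because the path of a child extends
     that of its parent. *)
  have hcons b : {in vertices (child_subtree l r b), forall p,
       h (b :: p) = (b (+) c) :: behead (h (b :: p))}.
    move=> p; elim/last_ind: p => [_|p d IH Sp]; first by rewrite h1.
    have Sp' := rcons_vertices Sp.
    have : path_child (h (b :: p)) (h (b :: rcons p d)).
      rewrite (path_iso_child hP) ?mem_cons_vertices // -rcons_cons.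
      by apply/path_childP; exists d.
    by rewrite (IH Sp') => /path_childP[d' ->].
  exists c => b; split=> //; split.
  - move=> p Sp; rewrite -mem_cons_vertices -hcons //.
    by rewrite (path_iso_mem hP) ?mem_cons_vertices.
  - move=> q Tq; have [|[|b' p]] := path_iso_surj hP (x := (b (+) c) :: q).
    + by rewrite mem_cons_vertices.
    + by rewrite (path_iso_nil hP).
    rewrite mem_cons_vertices => Sp; rewrite hcons // => -[/addIb eb hq].
    by exists p; rewrite -eb.
  - move=> p q Sp Sq epq; suff [] : b :: p = b :: q by [].
    by apply: (path_iso_inj hP); rewrite ?mem_cons_vertices // hcons // [RHS]hcons // epq.
  - by rewrite h1.
  move=> p q Sp Sq; have := path_iso_child hP (x := b :: p) (y := b :: q).
  rewrite !mem_cons_vertices => /(_ Sp Sq).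
  by rewrite hcons // [h (b :: q)]hcons // !path_child_cons !eqxx.
have hE b p : p \in vertices (child_subtree l r b) ->
    h (b :: p) = (b (+) c) :: behead (h (b :: p)) by case: (hc b) => + _; apply.
have hI b : path_iso (child_subtree l r b) (child_subtree l' r' (b (+) c))
      (fun p => behead (h (b :: p))) by case: (hc b).
split=> //.
- move=> [|b p]; first by rewrite h0.
  rewrite mem_cons_vertices => Sp; rewrite hE // mem_cons_vertices.
  exact: (path_iso_mem (hI b)).
- move=> [|b q]; first by exists [::].
  rewrite mem_cons_vertices => Tq.
  (* Exclusive or with [c] is an involution, so the paths starting with [b] come from the subtree
     indexed by [b (+) c]. *)
  have [|p Sp eq] := path_iso_surj (hI (b (+) c)) (x := q); first by rewrite addbK.
  by exists ((b (+) c) :: p); rewrite ?mem_cons_vertices // hE // eq addbK.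
- move=> [|b p] [|b' q] //; rewrite ?mem_cons_vertices.
  + by move=> _ Sq; rewrite h0 hE.
  + by move=> Sp _; rewrite h0 hE.
  move=> Sp Sq; rewrite hE // [h (b' :: q)]hE // => -[/addIb eb].
  by rewrite -eb in Sq * => /(path_iso_inj (hI b) Sp Sq) ->.
move=> [|b p] [|b' q] //; rewrite ?mem_cons_vertices.
- by rewrite h0.
- move=> _ Sq; rewrite h0 hE // !path_child_nil /=.
  by rewrite (path_iso_size (hI b') Sq).
- by move=> Sp _; rewrite h0 hE //; apply/idP/idP => /size_path_child.
move=> Sp Sq; rewrite hE // [h (b' :: q)]hE // !path_child_cons.
rewrite (inj_eq (@addIb c)).
by have [eb|//] := eqVneq b b'; rewrite -eb in Sq *; apply: (path_iso_child (hI b)).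
Qed.

(* An isomorphism is encoded by the list of the images of [vertices S]. *)
Definition glue_graphs (c : bool) (f g : seq (seq bool)) : seq (seq bool) :=
  [::] :: map (cons c) f ++ map (cons (~~ c)) g.

Fixpoint iso_graphs S T : seq (seq (seq bool)) :=
  match S, T with
  | Leaf, Leaf => [:: [:: [::]]]
  | Node a b, Node l r =>
      [seq glue_graphs false f g | f <- iso_graphs a l, g <- iso_graphs b r] ++
      [seq glue_graphs true f g | f <- iso_graphs a r, g <- iso_graphs b l]
  | _, _ => [::]
  end.

(** Puts both halves of the enumeration in one form: [c] tells whether the children of the root are
    exchanged. *)
Lemma mem_iso_graphs_node a b l r x :
  reflect (exists c f g, [/\ f \in iso_graphs a (child_subtree l r c),
             g \in iso_graphs b (child_subtree l r (~~ c)) & x = glue_graphs c f g])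
    (x \in iso_graphs (Node a b) (Node l r)).
Proof.
rewrite /= mem_cat; apply: (iffP orP) => [[]/allpairsP[[f g] /= [? ? ->]]|].
- by exists false, f, g.
- by exists true, f, g.
by move=> [[] [f [g [? ? ->]]]]; [right|left]; apply/allpairsP; exists (f, g).
Qed.

Lemma size_iso_graph S T f : f \in iso_graphs S T -> size f = size (vertices S).
Proof.
elim: S T f => [|a IHa b IHb] [|l r] f //; first by rewrite inE => /eqP ->.
case/mem_iso_graphs_node => c [f1 [g1 [/IHa e1 /IHb e2 ->]]].
by rewrite /= !size_cat !size_map e1 e2.
Qed.

(** All graphs with a given source have the same length, so a glued list can be cut back into its
    two parts. The straight and crossed halves are disjoint: the first path after the root starts
    with [false] in one and with [true] in the other. *)
Lemma uniq_iso_graphs S T : uniq (iso_graphs S T).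
Proof.
have inj c : injective (map (cons c) : seq (seq bool) -> _).
  by apply: inj_map => ? ? [].
elim: S T => [|a IHa b IHb] [|l r] //=; rewrite cat_uniq !allpairs_uniq //=.
- rewrite andbT; apply/hasPn => _ /allpairsP[[f g] /= [If Ig ->]].
  apply/allpairsP => -[[f' g'] /= [If' Ig' [] /eqP]].
  rewrite eqseq_cat ?size_map ?(size_iso_graph If) ?(size_iso_graph If') //.
  case/andP => + _; have := size_iso_graph If.
  (* The list [f] is nonempty, since [a] has a root, so the two heads can be compared. *)
  by case: f {If} (f') => [|x f] [|x' {}f'] //=; case: (a).
- move=> _ _ /allpairsP[[f g] /= [If Ig ->]] /allpairsP[[f' g'] /= [If' Ig' ->]].
  move=> [] /eqP.
  rewrite eqseq_cat ?size_map ?(size_iso_graph If) ?(size_iso_graph If') //.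
  by case/andP => /eqP /inj -> /eqP /inj ->.
move=> _ _ /allpairsP[[f g] /= [If Ig ->]] /allpairsP[[f' g'] /= [If' Ig' ->]].
move=> [] /eqP.
rewrite eqseq_cat ?size_map ?(size_iso_graph If) ?(size_iso_graph If') //.
by case/andP => /eqP /inj -> /eqP /inj ->.
Qed.

(** Soundness and completeness of the enumeration: its recursion matches the decomposition of an
    isomorphism at the root. *)
Lemma path_iso_graph S T h :
  path_iso S T h <-> map h (vertices S) \in iso_graphs S T.
Proof.
elim: S T h => [|a IHa b IHb] [|l r] h.
- by rewrite path_iso_leaf /= inE; split=> [->|/eqP []].
- by split=> // /path_iso_leaf_node.
- by split=> // /path_iso_node_leaf.
rewrite path_iso_node; split.
  move=> [h0 [c hc]]; have [fa Ia] := hc false; have [fb Ib] := hc true.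
  apply/mem_iso_graphs_node; exists c.
  exists (map (fun p => behead (h (false :: p))) (vertices a)).
  exists (map (fun p => behead (h (true :: p))) (vertices b)).
  split; [exact/IHa | exact/IHb | rewrite /= h0 /glue_graphs map_cat -!map_comp].
  by congr (_ :: _ ++ _); apply/eq_in_map => p Sp /=; [rewrite fa | rewrite fb].
case/mem_iso_graphs_node => c [f [g [If Ig]]].
rewrite /= map_cat -!map_comp => -[h0 /eqP].
rewrite eqseq_cat ?size_map ?(size_iso_graph If) // => /andP[/eqP ef /eqP eg].
have ef' : f = map (fun p => behead (h (false :: p))) (vertices a).
  have : map behead (map (cons c) f) = f by rewrite -map_comp map_id.
  by rewrite -ef -map_comp.
have eg' : g = map (fun p => behead (h (true :: p))) (vertices b).
  have : map behead (map (cons (~~ c)) g) = g by rewrite -map_comp map_id.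
  by rewrite -eg -map_comp.
split=> //; exists c => -[]; rewrite ?addFb ?addTb; split.
- by move: eg; rewrite eg' -map_comp => /eq_in_map.
- by apply/IHb; rewrite -eg'.
- by move: ef; rewrite ef' -map_comp => /eq_in_map.
by apply/IHa; rewrite -ef'.
Qed.

(** * Counting the isomorphisms between vertex sets *)

Definition tree_isos S T : {set {ffun vertex S -> vertex T}} :=
  [set f : {ffun vertex S -> vertex T} |
    [&& injectiveb f, [forall y, y \in codom f] & rooted_morph f]].

(** The value [[::]] outside the vertices of [S] is a default that [path_iso] never inspects. *)
Definition path_ext S T (f : {ffun vertex S -> vertex T}) (x : seq bool) :=
  oapp (fun y : vertex S => val (f y)) [::] (insub x).

Lemma path_ext_val S T (f : {ffun vertex S -> vertex T}) x :
  path_ext f (val x) = val (f x).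
Proof. by rewrite /path_ext valK. Qed.

Lemma tree_isosP S T (f : {ffun vertex S -> vertex T}) :
  (f \in tree_isos S T) <-> path_iso S T (path_ext f).
Proof.
pose rt U : vertex U := SeqSub (mem_nil_vertices U).
have extE x (Sx : x \in vertices S) : path_ext f x = val (f (SeqSub Sx)).
  by rewrite -path_ext_val.
rewrite inE; split=> [/and3P[/injectiveP fI /forallP fS /andP[/forallP fR /forallP fC]]|fP].
  have f0 : path_ext f [::] = [::].
    have := fR (rt S); rewrite /is_root -path_ext_val /= eqxx.
    by move=> /eqP/eqP.
  split=> //.
  - by move=> x Sx; rewrite extE; apply: valP.
  - move=> y Ty; have /codomP[x /(congr1 val) /= ->] := fS (SeqSub Ty).
    by exists (val x); [apply: valP | rewrite path_ext_val].
  - by move=> x y Sx Sy; rewrite !extE => /val_inj /fI [].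
  move=> x y Sx Sy; rewrite !extE.
  by have /forallP/(_ (SeqSub Sy))/eqP := fC (SeqSub Sx).
apply/and3P; split.
- apply/injectiveP => x y exy; apply/val_inj.
  apply: (path_iso_inj fP (valP x) (valP y)).
  by rewrite [LHS]path_ext_val exy -path_ext_val.
- apply/forallP => y; have [x Sx] := path_iso_surj fP (valP y).
  by rewrite extE => /val_inj <-; apply: codom_f.
apply/andP; split.
  apply/forallP => x; rewrite /is_root -[ssval (f x)]path_ext_val.
  apply/eqP; apply/idP/idP => /eqP e; apply/eqP; last by rewrite [val x]e (path_iso_nil fP).
  by apply: (path_iso_inj fP (valP x)); rewrite // e (path_iso_nil fP).
apply/forallP => x; apply/forallP => y; apply/eqP.
by rewrite /is_child -![ssval (f _)]path_ext_val; apply: (path_iso_child fP); apply: valP.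
Qed.

(** Sending an isomorphism to its list of values on [vertices S] is injective, and [path_iso_graph]
    identifies the image with the duplicate-free list [iso_graphs S T]. *)
Lemma card_tree_isos S T : #|tree_isos S T| = size (iso_graphs S T).
Proof.
rewrite cardE -(size_map (fun f => map (path_ext f) (vertices S))).
apply/perm_size/uniq_perm; rewrite ?uniq_iso_graphs //.
  rewrite map_inj_uniq ?enum_uniq // => f g /eq_in_map efg.
  apply/ffunP => x; apply: val_inj; rewrite -!path_ext_val.
  by apply: efg; apply: valP.
move=> L; apply/mapP/idP => [[f + ->]|SL].
  by rewrite mem_enum => /tree_isosP/path_iso_graph.
(* The list [L] is read as a table of values, indexed by the position of a path in [vertices S]. *)
pose h x := nth [::] L (index x (vertices S)).
have hL : L = map h (vertices S).
  apply: (@eq_from_nth _ [::]); rewrite ?size_map ?(size_iso_graph SL) //.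
  by move=> i Si; rewrite (nth_map [::]) // /h index_uniq ?uniq_vertices.
have hP : path_iso S T h by apply/path_iso_graph; rewrite -hL.
pose f : {ffun vertex S -> vertex T} :=
  [ffun x => SeqSub (path_iso_mem hP (valP x))].
have fh : L = map (path_ext f) (vertices S).
  rewrite hL; apply/eq_in_map => x Sx.
  by rewrite -[x]/(val (SeqSub Sx)) path_ext_val ffunE.
exists f; rewrite // mem_enum; apply/tree_isosP/path_iso_graph.
by rewrite -fh.
Qed.

(** * The number of isomorphisms between two trees *)

Definition niso S T := size (iso_graphs S T).

Lemma niso_node a b l r :
  niso (Node a b) (Node l r) = (niso a l * niso b r + niso a r * niso b l)%N.
Proof. by rewrite /niso /= size_cat !size_allpairs. Qed.

Lemma tree_iso_niso S T : tree_iso S T = (0 < niso S T)%N.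
Proof.
rewrite /niso -card_tree_isos card_gt0; apply/existsP/set0Pn.
  by move=> [f fP]; exists f; rewrite inE.
by move=> [f]; rewrite inE; exists f.
Qed.

(** A permutation is bijective, so being an isomorphism reduces to [rooted_morph]; conversely, an
    injective self-map of a finite set is a permutation. *)
Lemma card_tree_aut T : #|tree_aut T| = niso T T.
Proof.
pose g (s : {perm vertex T}) := [ffun x => s x].
have gI : injective g by move=> s t /ffunP e; apply/permP => x; have := e x; rewrite !ffunE.
have rmE s : rooted_morph (g s) = rooted_morph s.
  rewrite /rooted_morph; congr (_ && _); apply: eq_forallb => x; rewrite ?ffunE //.
  by apply: eq_forallb => y; rewrite !ffunE.
rewrite /niso -card_tree_isos -(card_imset _ gI); apply: eq_card => f.
rewrite [RHS]inE; apply/imsetP/and3P => [[s + ->]|[fI _ fR]].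
  rewrite inE -rmE => sR; split=> //.
    by apply/injectiveP => x y; rewrite !ffunE => /perm_inj.
  by apply/forallP => y; apply/codomP; exists (s^-1 y)%g; rewrite ffunE permKV.
have fE : f = g (perm (injectiveP _ fI)) by apply/ffunP => x; rewrite ffunE permE.
by exists (perm (injectiveP _ fI)); rewrite // inE -rmE -fE.
Qed.

(** Composition with a fixed isomorphism from [S] to [T] explains the equality; the recursion
    [niso_node] gives it numerically. With [U] equal to [T], it yields the order of the automorphism
    group of [T]. *)
Lemma niso_eq S T U : (0 < niso S T)%N -> niso S U = niso T U.
Proof.
elim: S T U => [|a IHa b IHb] [|l r] [|l' r'] //; rewrite !niso_node addn_gt0 !muln_gt0.
case/orP => /andP[al br]; first by rewrite !(IHa _ _ al) !(IHb _ _ br).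
by rewrite !(IHa _ _ al) !(IHb _ _ br) addnC; congr (_ + _)%N; apply: mulnC.
Qed.

Lemma niso_nleaves S T : (0 < niso S T)%N -> nleaves S = nleaves T.
Proof.
elim: S T => [|a IHa b IHb] [|l r] //; rewrite !niso_node addn_gt0 !muln_gt0 /=.
by case/orP => /andP[/IHa -> /IHb ->] //; rewrite addnC.
Qed.

Lemma uniq_pbtree_enum n : uniq (pbtree_enum n).
Proof.
elim: n => //= n IH; rewrite allpairs_uniq //; last by move=> [? ?] [? ?] _ _ [-> ->].
by rewrite andbT; apply/allpairsP => -[[? ?] []].
Qed.

(** Passes from the finite type [PT k] to the list [pbtree_enum k], whose recursive shape suits
    induction. The list also holds trees with other numbers of leaves; positivity of [niso] discards
    them. *)
Lemma big_planar_embeddings (A : nmodType) k (T : PT k) (G : pbtree -> A) :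
  \sum_(S in planar_embeddings T) G S =
  \sum_(S <- pbtree_enum k | (0 < niso S T)%N) G S.
Proof.
rewrite -[LHS]big_filter -[RHS]big_filter -(big_map (@ptree k) xpredT G).
apply/perm_big; rewrite perm_sym; apply: uniq_perm.
- by rewrite filter_uniq ?uniq_pbtree_enum.
- by rewrite map_inj_uniq ?filter_uniq ?index_enum_uniq //; apply: val_inj.
move=> S; rewrite mem_filter; apply/andP/mapP => [[ST _]|[S' + ->]].
  have Sk : nleaves S == k by rewrite (niso_nleaves ST) (valP T).
  exists (MkPT Sk); rewrite // mem_filter mem_index_enum inE tree_iso_niso.
  by rewrite ST.
rewrite mem_filter inE tree_iso_niso => /andP[-> _]; split=> //.
by apply: mem_pbtree_enum; rewrite (eqP (valP S')).
Qed.

End Trees.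

(** * Signs determined by parity *)

Section Signs.
Variable F : fieldType.

Lemma sign_mod2 (m n : int) : (2 %| m - n)%Z -> (-1 : F) ^ m = (-1) ^ n.
Proof.
case/dvdzP => q e; have -> : m = q * 2 + n by rewrite -e subrK.
rewrite expfzDr ?oppr_eq0 ?oner_eq0 // mulrC -exprz_exp -[2%R]/(2%:Z) exprzAC.
by rewrite -exprnP sqrrN expr1n exp1rz mulr1.
Qed.

Lemma signzM (m : int) : (-1 : F) ^ m * (-1) ^ m = 1.
Proof.
by rewrite -expfzDr ?oppr_eq0 ?oner_eq0 // (@sign_mod2 _ 0) ?expr0z //; lia.
Qed.
End Signs.

(** * Spans of words, brackets, and tensor products of maps *)

Section Span.
Variables (F : fieldType) (V : int -> lmodType F).
Local Notation TA := (tensor_algebra V).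
Implicit Types (P Q R : pred (seq (homelt V))) (x y : TA).

Lemma word_span_word P s : P s -> word_span P (word s).
Proof.
by move=> Ps; exists [:: (1, s)]; rewrite /= Ps big_seq1 scale1r.
Qed.

Lemma word_span0 P : word_span P 0.
Proof. by exists [::]; rewrite big_nil. Qed.

Lemma word_spanZ P a x : word_span P x -> word_span P (a *: x).
Proof.
move=> [r [rP ->]]; exists [seq (a * c.1, c.2) | c <- r]; split.
  by rewrite all_map.
by rewrite big_map scaler_sumr; apply: eq_bigr => c _; rewrite scalerA.
Qed.

Lemma word_spanD P x y : word_span P x -> word_span P y -> word_span P (x + y).
Proof.
move=> [r [rP ->]] [r' [rP' ->]]; exists (r ++ r').
by rewrite all_cat rP rP' big_cat.
Qed.

Lemma word_span_sum P (I : Type) (r : seq I) (G : I -> TA) :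
  (forall j, word_span P (G j)) -> word_span P (\sum_(j <- r) G j).
Proof.
move=> GP; apply: big_ind => //; [exact: word_span0 | exact: word_spanD].
Qed.

Lemma word_span_ind P (A : TA -> Prop) : A 0 ->
  (forall c s x, P s -> A x -> A (c *: word s + x)) ->
  forall x, word_span P x -> A x.
Proof.
move=> A0 AD x [r [rP ->]]; elim: r rP => [|c r IH] /=; rewrite ?big_nil //.
by move=> /andP[Pc /IH]; rewrite big_cons; apply: AD.
Qed.

Lemma word_spanT x : word_span predT x.
Proof.
rewrite -[x]reprK; elim/free_alg_ind: (repr x) => [|c s y IH].
  by rewrite raddf0; apply: word_span0.
rewrite tpiD tpiZ -wordE; apply: word_spanD IH.
exact/word_spanZ/word_span_word.
Qed.

Lemma word_spanM P Q R x y :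
  (forall s t, P s -> Q t -> R (s ++ t)) ->
  word_span P x -> word_span Q y -> word_span R (x * y).
Proof.
move=> PQ xP yQ; elim/word_span_ind: xP => [|c s {}x Ps IHx].
  by rewrite mul0r; apply: word_span0.
rewrite mulrDl -scalerAl; apply: word_spanD IHx; apply: word_spanZ.
elim/word_span_ind: yQ => [|d t {}y Qt IHy].
  by rewrite mulr0; apply: word_span0.
rewrite mulrDr -scalerAr; apply: word_spanD IHy; apply: word_spanZ.
by rewrite -word_cat; apply/word_span_word/PQ.
Qed.

Lemma bracket0r x : bracket x 0 = 0.
Proof.
have := bracket_linearr x (-1) 0 0.
by rewrite scaler0 addr0 scaleN1r addNr.
Qed.

(** The sign in the commutator depends only on the parities of the two degrees, which are constant
    on each span. *)
Lemma bracket_parity (i j : int) x y :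
  word_span (fun s => (2 %| wdeg s - i)%Z) x ->
  word_span (fun s => (2 %| wdeg s - j)%Z) y ->
  bracket x y = x * y - (-1 : F) ^ (i * j) *: (y * x).
Proof.
move=> xi yj; elim/word_span_ind: xi => [|c s {}x si IHx].
  by rewrite mul0r mulr0 scaler0 subrr /bracket linear0.
rewrite bracket_linearl IHx mulrDl mulrDr -!scalerAl -!scalerAr.
have -> : bracket (word s) y =
    word s * y - (-1 : F) ^ (i * j) *: (y * word s).
  elim/word_span_ind: yj {IHx} => [|d t {}y tj IHy].
    by rewrite bracket0r mul0r mulr0 scaler0 subrr.
  rewrite bracket_linearr IHy mulrDl mulrDr -!scalerAl -!scalerAr.
  rewrite bracket_word /bracket_words !word_cat (@sign_mod2 F _ (i * j)).
    rewrite scalerBr scalerDr !scalerA [d * _]mulrC opprD addrACA.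
    by [].
  by have := dvdz_mul; nia.
rewrite scalerBr scalerDr !scalerA [c * _]mulrC opprD addrACA.
by [].
Qed.

(** Such an [L] sees only the component of length two and is graded symmetric there, whereas that
    component of a Lie element is graded antisymmetric. Identities on the image of [phi] can thus be
    checked on words of two letters. *)
Lemma free_lie_killed (M : lmodType F) (L : {linear TA -> M}) :
  (forall s, size s != 2 -> L (word s) = 0) ->
  (forall a b, L (word [:: a; b]) = (-1 : F) ^ (tag a * tag b) *: L (word [:: b; a])) ->
  forall x, free_lie x -> L x = 0.
Proof.
move=> L0 L2 x; elim=> {x} [i v|x y _ _ _ _||a x y _ Lx _ Ly].
- exact: L0.
- elim/word_span_ind: (word_spanT x) => [|c s {}x _ IHx].
    by rewrite /bracket !linear0.
  rewrite bracket_linearl linearP /= IHx addr0.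
  suff -> : L (bracket (word s) y) = 0 by rewrite scaler0.
  elim/word_span_ind: (word_spanT y) {IHx} => [|d t {}y _ IHy].
    by rewrite bracket0r linear0.
  rewrite bracket_linearr linearP /= IHy addr0 bracket_word /bracket_words.
  suff -> : L (word (s ++ t) - (-1 : F) ^ (wdeg s * wdeg t) *: word (t ++ s)) = 0.
    by rewrite scaler0.
  (* Both words in the bracket have the same length; unless it is two, [L] kills them. *)
  have [|st] := eqVneq (size (s ++ t)) 2%N; last first.
    by rewrite linearB linearZ /= !L0 ?scaler0 ?subr0 // size_cat addnC -size_cat.
  (* The splittings are 0+2, 1+1 and 2+0. The empty word is the unit, of degree 0, so brackets with
     it vanish; two letters are handled by the symmetry of [L]. *)
  case: s t {IHy} => [|a [|b [|? ?]]] [|a' [|b' [|? ?]]] //= _; rewrite ?cats0 /wdeg.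
  + by rewrite big_nil mul0r expr0z scale1r subrr linear0.
  + by rewrite !big_seq1 linearB linearZ /= L2 subrr.
  by rewrite big_nil mulr0 expr0z scale1r subrr linear0.
- exact: linear0.
by rewrite linearP /= Lx Ly scaler0 addr0.
Qed.

(** Cutting a word after its first [m] letters recovers the two factors when their lengths are [m]
    and [n]. *)
Lemma bracket_map_mul m n (f g : {linear TA -> TA}) x y :
  tensor_length m x -> tensor_length n y ->
  bracket_map m n f g (x * y) = bracket (f x) (g y).
Proof.
move=> xm yn; elim/word_span_ind: xm => [|c s {}x /eqP sm IHx].
  by rewrite mul0r !linear0 /bracket linear0.
rewrite mulrDl -scalerAl [LHS]linearP [f _]linearP /= IHx bracket_linearl.
congr (_ *: _ + _); elim/word_span_ind: yn {IHx} => [|d t {}y /eqP tn IHy].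
  by rewrite mulr0 !linear0 bracket0r.
rewrite mulrDr -scalerAr [LHS]linearP [g _]linearP /= IHy bracket_linearr.
rewrite -word_cat {1}/bracket_map lift_word /= /bracket_map_words.
by rewrite size_cat sm tn eqxx -sm take_size_cat // drop_size_cat.
Qed.

Section Tens2.
Variable A : algType F.
Implicit Types f g : forall i, {linear V i -> A}.

Lemma tens2_word f g s : tens2 f g (word s) =
  if s is [:: a; b] then f (tag a) (tagged a) * g (tag b) (tagged b) else 0.
Proof. by rewrite /tens2 lift_word. Qed.

(** Bilinearity of the tensor product in the pair of maps, in the form needed to expand over pairs
    of subtrees. *)
Lemma tens2_sum (I : Type) (r : seq I) (c d : I -> F)
    (f g : I -> forall i, {linear V i -> A}) f' g' :
  (forall i v, f' i v = \sum_(j <- r) c j *: f j i v) ->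
  (forall i v, g' i v = \sum_(j <- r) d j *: g j i v) ->
  forall x, tens2 f' g' x =
    \sum_(j <- r) \sum_(l <- r) (c j * d l) *: tens2 (f j) (g l) x.
Proof.
move=> fE gE x; elim/word_span_ind: (word_spanT x) => [|a s {}x _ IH].
  by rewrite linear0 !big1 // => j _; rewrite big1 // => l _; rewrite linear0 scaler0.
rewrite linearP /= IH.
have -> : tens2 f' g' (word s) =
    \sum_(j <- r) \sum_(l <- r) (c j * d l) *: tens2 (f j) (g l) (word s).
  rewrite tens2_word; case: s => [|u [|w [|? ?]]];
    try by rewrite !big1 // => j _; rewrite big1 // => l _; rewrite tens2_word scaler0.
  rewrite fE gE mulr_suml; apply: eq_bigr => j _; rewrite mulr_sumr.
  by apply: eq_bigr => l _; rewrite tens2_word -scalerAl -scalerAr scalerA.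
rewrite scaler_sumr -big_split; apply: eq_bigr => j _.
rewrite scaler_sumr -big_split; apply: eq_bigr => l _ /=.
by rewrite linearP scalerDr !scalerA [a * _]mulrC.
Qed.

End Tens2.

End Span.

(** * The maps attached to trees: recursion, length and parity *)

Section TreeMaps.
Variables (F : fieldType) (V W : int -> lmodType F).
Variables (p : int) (psi : forall i, {linear V i -> W (i + p)}).

Lemma tmapM x y : tmap psi (x * y) = tmap psi x * tmap psi y.
Proof.
elim/word_span_ind: (word_spanT x) => [|c s {}x _ IHx].
  by rewrite mul0r !linear0 mul0r.
rewrite mulrDl -scalerAl !linearP /= IHx mulrDl -scalerAl; congr (_ *: _ + _).
elim/word_span_ind: (word_spanT y) {IHx} => [|d t {}y _ IHy].
  by rewrite mulr0 !linear0 mulr0.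
rewrite mulrDr -scalerAr !linearP /= IHy mulrDr -scalerAr; congr (_ *: _ + _).
by rewrite -word_cat /tmap !lift_word /= /tmap_words map_cat word_cat.
Qed.

Variable phi : forall i, {linear V i -> tensor_algebra V}.
Local Notation PT := (P_tree phi psi).

Lemma P_tree_leaf i (v : V i) : PT Leaf i v = word [:: helt (psi i v)].
Proof. by rewrite /= /tmap /gen lift_word. Qed.

(** Since [tmap psi] is multiplicative, it can be pushed to the leaves, and the recursion of
    [phi_tree] carries over. *)
Lemma P_tree_node l r i (v : V i) :
  PT (Node l r) i v = tens2 (PT l) (PT r) (phi i v).
Proof.
rewrite /=; elim/word_span_ind: (word_spanT (phi i v)) => [|c s x _ IH].
  by rewrite !linear0.
rewrite !linearP /= IH; congr (_ *: _ + _); rewrite !tens2_word.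
by case: s => [|a [|b []]] *; rewrite ?linear0 ?tmapM.
Qed.

(** Ensures that the bracket at a vertex cuts a tensor exactly between the factors of its two
    subtrees. *)
Lemma P_tree_length T i (v : V i) : tensor_length (nleaves T) (PT T i v).
Proof.
elim: T i v => [|l IHl r IHr] i v.
  by rewrite P_tree_leaf; apply: word_span_word.
rewrite P_tree_node.
elim/word_span_ind: (word_spanT (phi i v)) => [|c s x _ IH].
  by rewrite linear0; apply: word_span0.
rewrite linearP /=; apply: word_spanD IH; apply: word_spanZ.
rewrite tens2_word; case: s => [|a [|b []]] *; try exact: word_span0.
apply: word_spanM (IHl _ _) (IHr _ _) => s t /eqP sl /eqP tr.
by rewrite size_cat sl tr.
Qed.

Hypothesis p_even : (2 %| p)%Z.
Hypothesis phi_even : parity_preserving phi.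

Lemma P_tree_parity T i (v : V i) :
  word_span (fun s => (2 %| wdeg s - i)%Z) (PT T i v).
Proof.
elim: T i v => [|l IHl r IHr] i v.
  rewrite P_tree_leaf; apply: word_span_word.
  (* At a leaf the degree changes by [p], which is even. *)
  by rewrite /wdeg big_seq1 /= addrC addKr.
rewrite P_tree_node.
elim/word_span_ind: (phi_even v) => [|c s x si IH].
  by rewrite linear0; apply: word_span0.
rewrite linearP /=; apply: word_spanD IH; apply: word_spanZ.
rewrite tens2_word; case: s si => [|a [|b [|? ?]]] si; try exact: word_span0.
apply: word_spanM (IHl _ _) (IHr _ _) => s t.
move: si; rewrite /wdeg big_cons big_seq1 big_cat /= -!/(wdeg _).
move: (wdeg s) (wdeg t) (tag a) (tag b) => m n ia ib; lia.
Qed.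

(** * Expansion of the bracketed tree maps *)

Hypothesis phi_lie : forall i (v : V i), free_lie (phi i v).

Definition QP_tree T i : {linear V i -> tensor_algebra W} := Q_tree W T \o PT T i.

(** By the parity hypotheses, the bracket of the values of the subtree maps at [a] and [b] carries
    the sign given by the degrees of [a] and [b] themselves. *)
Lemma QP_tree_node l r i (v : V i) :
  (forall i (v : V i), word_span (fun s => (2 %| wdeg s - i)%Z) (QP_tree l i v)) ->
  (forall i (v : V i), word_span (fun s => (2 %| wdeg s - i)%Z) (QP_tree r i v)) ->
  QP_tree (Node l r) i v =
  tens2 (QP_tree l) (QP_tree r) (phi i v) + tens2 (QP_tree r) (QP_tree l) (phi i v).
Proof.
move=> l_par r_par.
have -> : QP_tree (Node l r) i v = Q_tree W (Node l r) (PT (Node l r) i v) by [].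
rewrite P_tree_node; apply/eqP; rewrite -subr_eq0; apply/eqP.
(* [L] is the difference of the two sides as a function of [phi i v]; the formula [Lab] shows that
   it is graded symmetric on two letters. *)
pose L : {linear tensor_algebra V -> tensor_algebra W} :=
  (Q_tree W (Node l r) \o tens2 (PT l) (PT r)) \-
  (tens2 (QP_tree l) (QP_tree r) \+ tens2 (QP_tree r) (QP_tree l)).
have Lab a b : L (word [:: a; b]) =
    - ((-1 : F) ^ (tag a * tag b) *:
         (QP_tree r (tag b) (tagged b) * QP_tree l (tag a) (tagged a))
       + QP_tree r (tag a) (tagged a) * QP_tree l (tag b) (tagged b)).
  rewrite [LHS]/= !tens2_word bracket_map_mul; try exact: P_tree_length.
  rewrite (bracket_parity (l_par _ _) (r_par _ _)).
  by rewrite opprD addrACA subrr add0r opprD.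
apply: (free_lie_killed (L := L)) (phi_lie v) => [s s2|a b].
  rewrite /L /= !tens2_word; case: s s2 => [|? [|? []]] //= *;
  by rewrite linear0 addr0 subr0.
(* Exchanging [a] and [b] swaps the two summands up to the sign, whose square is 1. *)
rewrite !Lab scalerN scalerDr scalerA [tag b * _]mulrC signzM scale1r.
by rewrite addrC.
Qed.

(** The bound [h] decreases with the depth, because [pbtree_enum h.+1] is the leaf followed by all
    graftings of pairs from [pbtree_enum h]. *)
Lemma QP_tree_expansion h T i (v : V i) : (nleaves T <= h)%N ->
  QP_tree T i v = \sum_(S <- pbtree_enum h) (niso S T)%:R *: PT S i v.
Proof.
elim: T h i v => [|l IHl r IHr] [|h] i v Th.
- by [].
(* Only the leaf is isomorphic to a leaf, by a single isomorphism. *)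
- rewrite big_cons /= scale1r big_seq big1 ?addr0 // => S.
  by case/allpairsP => -[a b] [_ _ ->]; rewrite scale0r.
- by move: Th; rewrite leqNgt nleaves_gt0.
rewrite /= in Th.
(* Each subtree omits at least one leaf of the other, so the smaller bound suffices. *)
have lh : (nleaves l <= h)%N by have := nleaves_gt0 r; lia.
have rh : (nleaves r <= h)%N by have := nleaves_gt0 l; lia.
have {lh}IHl j u := IHl h j u lh; have {rh}IHr j u := IHr h j u rh.
(* The expansion of a subtree map into the maps [PT S] transfers their parity to it, as
   [QP_tree_node] requires. *)
have par T' : (forall i (v : V i),
      QP_tree T' i v = \sum_(S <- pbtree_enum h) (niso S T')%:R *: PT S i v) ->
    forall i (v : V i), word_span (fun s => (2 %| wdeg s - i)%Z) (QP_tree T' i v).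
  move=> E j u; rewrite E; apply: word_span_sum => S.
  exact/word_spanZ/P_tree_parity.
rewrite (QP_tree_node _ (par _ IHl) (par _ IHr)).
rewrite (tens2_sum IHl IHr) (tens2_sum IHr IHl) -big_split.
(* The leaf contributes 0; the rest is a double sum over left and right subtrees, to be compared
   term by term through [niso_node]. *)
rewrite big_cons scale0r add0r big_allpairs_dep; apply: eq_bigr => a _.
rewrite -big_split; apply: eq_bigr => b _.
by rewrite P_tree_node niso_node natrD !natrM scalerDl.
Qed.

End TreeMaps.

(** * Division by the order of the automorphism group *)

Theorem theorem2p1 (F : fieldType) (F_char0 : [pchar F] =i pred0)
    (V W : int -> lmodType F)
    (phi : forall i, {linear V i -> tensor_algebra V})
    (phi_lie2 : forall i (v : V i), free_lie_length 2 (phi i v))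
    (phi_even : parity_preserving phi)
    (p : int) (p_even : (2 %| p)%Z)
    (psi : forall i, {linear V i -> W (i + p)})
    (k : nat) (k_ge2 : (2 <= k)%N) (T : PT k) (i : int) (v : V i) :
  (#|tree_aut T|%:R)^-1 *: Q_tree W T (P_tree phi psi T i v) =
  \sum_(S in planar_embeddings T) P_tree phi psi S i v.
Proof.
have phi_lie j (u : V j) : free_lie (phi j u) by case: (phi_lie2 j u).
have Tk : (nleaves T <= k)%N by rewrite (eqP (valP T)).
have := QP_tree_expansion psi p_even phi_even phi_lie v Tk; rewrite /QP_tree /= => ->.
rewrite (big_planar_embeddings T (fun S => P_tree phi psi S i v)) scaler_sumr.
(* Both sides are now sums over the same list, where a tree not isomorphic to [T] contributes 0. *)
rewrite [RHS]big_mkcond; apply: eq_bigr => S _; rewrite card_tree_aut scalerA.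
case: ltnP => [ST|]; last by rewrite leqn0 => /eqP ->; rewrite mulr0 scale0r.
(* The coefficient [niso S T] equals [niso T T], a positive integer, hence invertible in
   characteristic 0. *)
rewrite (niso_eq T ST) mulVf ?scale1r //.
by have /pcharf0P -> := F_char0; rewrite -lt0n -(niso_eq T ST).
Qed.
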